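(* Let $s\in\mathbb{N}$ and let $D^\alpha$ be the derivative of order $\alpha$ in the multi-index notation. For the static case, the derivatives of the tensor field $h_{\mu\nu}(\mathbf{x})=(\mathcal{E}_{(\ell)}\ast\Phi_{\mu\nu})(\mathbf{x})$, $\mathbf{x}\in\mathbb{R}^3$, are bounded by $$|D^\alpha h_{\mu\nu}(\mathbf{x})|\le C_{\mu\nu}\,(1+|\mathbf{x}|^s),$$ where $C_{\mu\nu}$ is a constant tensor.
   Context: Here $\ell>0$ and $\mathcal{E}_{(\ell)}(\mathbf{x})=\frac{1}{(2\ell\sqrt{\pi})^3}e^{-\frac{|\mathbf{x}|^2}{4\ell^2}}$ for $\mathbf{x}\in\mathbb{R}^3$. The indices $\mu,\nu$ run over $0,\dots,3$, and $\Phi_{\mu\nu}$ are regular tempered distributions, i.e. tempered distributions given by locally integrable functions $f$ of slow growth ($\int |f(\mathbf{x})|(1+|\mathbf{x}|^2)^{-r/2}\,d\mathbf{x}<\infty$ for a certain $r\ge 0$). ''Static'' means that the fields do not depend on time, so that $\Phi_{\mu\nu}$ and $h_{\mu\nu}$ are considered on $\mathbb{R}^3$. The convolution means $h_{\mu\nu}(\mathbf{x})=\left(\Phi_{\mu\nu}(\mathbf{x}^\prime),\mathcal{E}_{(\ell)}(\mathbf{x}-\mathbf{x}^\prime)\right)$, the value of the distribution $\Phi_{\mu\nu}$ on the Schwartz function $\mathbf{x}^\prime\mapsto\mathcal{E}_{(\ell)}(\mathbf{x}-\mathbf{x}^\prime)$. For a multi-index $\alpha=(\alpha_1,\alpha_2,\alpha_3)$,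 $D^\alpha=\partial^{|\alpha|}/\partial x_1^{\alpha_1}\partial x_2^{\alpha_2}\partial x_3^{\alpha_3}$.
   Formalization: The bound fails for arbitrary s (e.g. Φ given by |x|^4, s = 1), so the formal theorem asserts that some s in N, depending on Φ but common to all α, μ, ν, works, with the constant tensor C allowed to depend on α; smoothness of h is also asserted. *)

(* Defs.v *)
From HB Require Import structures.
From mathcomp Require Export all_boot all_order all_algebra.
From mathcomp Require Export all_classical all_reals all_analysis.
Export Order.TTheory GRing.Theory Num.Theory.
Export numFieldNormedType.Exports.

#[export] Set Implicit Arguments.
#[export] Unset Strict Implicit.
#[export] Unset Printing Implicit Defensive.

Local Open Scope classical_set_scope.
Local Open Scope ring_scope.

Section Euclidean3.
Variable R : realType.

(* The points of R^3 are triples: R * R * R has both the normed-module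
   structure used for derivatives and the product Borel sigma-algebra.
   Its library norm is the sup norm, hence the separate enorm below. *)
Local Notation R3 := (R * R * R)%type.

Definition enorm (x : R3) : R :=
  Num.sqrt (x.1.1 ^+ 2 + x.1.2 ^+ 2 + x.2 ^+ 2).

Definition lebesgue3 :=
  ((@lebesgue_measure R \x @lebesgue_measure R) \x @lebesgue_measure R)%E.

Definition basis (i : 'I_3) : R3 :=
  ((i == 0 :> nat)%N%:R, (i == 1 :> nat)%N%:R, (i == 2 :> nat)%N%:R).

Definition partial (i : 'I_3) (f : R3 -> R) : R3 -> R :=
  fun x => 'D_(basis i) f x.

(* C^oo: the iterated partial derivatives, in any order, exist everywhere and
   are continuous.  Existence has to be required because 'D is total. *)
Definition smooth (f : R3 -> R) : Prop :=
  forall js : seq 'I_3, let g := foldr partial f js in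
    continuous g /\ forall (i : 'I_3) (x : R3), derivable g x (basis i).

Definition Dalpha (alpha : 'I_3 -> nat) (f : R3 -> R) : R3 -> R :=
  iter (alpha 0) (partial 0)
    (iter (alpha 1) (partial 1) (iter (alpha 2) (partial 2) f)).

End Euclidean3.

Section TemperedDistributions.
Variable R : realType.
Local Notation R3 := (R * R * R)%type.

Definition schwartz (phi : R3 -> R) : Prop :=
  smooth phi /\
  forall (k : nat) (alpha : 'I_3 -> nat), exists M : R, forall x,
    enorm x ^+ k * `|Dalpha alpha phi x| <= M.

Definition schwartz_cvg (phi_ : nat -> R3 -> R) (phi : R3 -> R) : Prop :=
  forall (k : nat) (alpha : 'I_3 -> nat) (e : R), 0 < e ->
    \forall n \near \oo, forall x,
      enorm x ^+ k * `|Dalpha alpha (phi_ n \- phi) x| <= e.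

(* A (real) distribution is represented by a functional on all functions
   R^3 -> R; only its values on Schwartz functions are meaningful. *)
Definition tempered (T : (R3 -> R) -> R) : Prop :=
  (forall (a : R) (phi psi : R3 -> R), schwartz phi -> schwartz psi ->
     T (fun x => a * phi x + psi x) = a * T phi + T psi) /\
  (forall (phi_ : nat -> R3 -> R) (phi : R3 -> R),
     (forall n, schwartz (phi_ n)) -> schwartz phi ->
     schwartz_cvg phi_ phi -> T (phi_ n) @[n --> \oo] --> T phi).

(* Counterpart on R^3 of the library's locally_integrable, which is restricted
   to R.  Borel measurability loses no regular distribution, as a Lebesgue
   measurable density is a.e. equal to a Borel one. *)
Definition locally_integrable3 (f : R3 -> R) : Prop :=
  measurable_fun
    [set: measurableTypeR R * measurableTypeR R * measurableTypeR R] f /\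
  forall K : set (R3), compact K ->
    (\int[@lebesgue3 R]_(x in K) `|f x|%:E < +oo)%E.

Definition slow_growth (f : R3 -> R) : Prop :=
  exists2 r : R, 0 <= r &
    (\int[@lebesgue3 R]_x
       (`|f x| * (1 + enorm x ^+ 2) `^ (- (r / 2)))%:E < +oo)%E.

Definition regular_tempered (T : (R3 -> R) -> R) : Prop :=
  tempered T /\
  exists f : R3 -> R,
    [/\ locally_integrable3 f, slow_growth f &
        forall phi, schwartz phi -> T phi = \int[@lebesgue3 R]_x (f x * phi x)].

Definition convolution (phi : R3 -> R) (T : (R3 -> R) -> R) : R3 -> R :=
  fun x => T (fun x' => phi (x - x')).

Definition gauss_kernel (l : R) (x : R3) : R :=
  ((2 * l * Num.sqrt pi) ^+ 3)^-1 * expR (- (enorm x ^+ 2 / (4 * l ^+ 2))).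

End TemperedDistributions.

(* Main.v *)
(* Every partial derivative of the Gaussian kernel is again a product of
   one-variable functions p(t) exp(-a t^2) with p a polynomial, and so decays
   faster than any power of w(x) = 1 + |x|^2. If f w^-n is integrable, then
   Peetre's inequality w(y) <= 2 w(x) w(x - y) bounds |f(y) g(x - y)|, for g in
   this class, by a constant times w(x)^n times the integrable function
   |f(y)| w(y)^-n. This allows differentiating under the integral sign and shows
   that all derivatives of the convolution are O(w^n), with the same n; their
   continuity follows from the mean value theorem, since their own partial
   derivatives are locally bounded. *)
Require Import Defs.
From mathcomp Require Import measurable_realfun ring lra.

Local Open Scope classical_set_scope.
Local Open Scope ring_scope.

(** * Directional derivatives, polynomial growth and smoothness on R^3 *)

Section DirectionalDerivatives.
Variable R : realType.
Local Notation R3 := (R * R * R)%type.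
Implicit Types (g u v w : R3 -> R) (x y : R3).

(** Both derivatives are limits of the same difference quotients. This reduces partial derivatives
    to one-variable calculus, where the mean value theorem, the chain rule and differentiation under
    the integral sign are at hand. *)
Lemma is_derive_line g (x b : R3) (t df : R) :
  is_derive (t *: b + x) b g df <-> is_derive t 1 (fun s : R => g (s *: b + x)) df.
Proof.
have E : (fun h : R => h^-1 *: (g (h *: b + (t *: b + x)) - g (t *: b + x))) =
    (fun h : R => h^-1 *: ((fun s : R => g (s *: b + x)) (h *: (1 : R) + t) -
                 (fun s : R => g (s *: b + x)) t)).
  by apply/funext => h /=; rewrite addrA -scalerDl /GRing.scale /= mulr1.
by split=> -[d1 d2]; split; move: d1 d2; rewrite /derivable /derive E.
Qed.

Lemma line_mean_value g g' (b x : R3) (s B : R) :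
  (forall y, is_derive y b g (g' y)) ->
  (forall t : R, `|t| <= `|s| -> `|g' (t *: b + x)| <= B) ->
  `|g (s *: b + x) - g x| <= B * `|s|.
Proof.
move=> gg' B_ub.
(* Rescaling the segment to [0, 1] treats both signs of [s] at once. *)
pose phi (t : R) := g ((t * s) *: b + x).
have dphi (t : R) : is_derive t 1 phi (g' ((t * s) *: b + x) * s).
  have d1 : is_derive (t * s) 1 (fun r : R => g (r *: b + x)) (g' ((t * s) *: b + x)).
    by apply/is_derive_line.
  have d2 : is_derive t 1 (fun r : R => r * s) s.
    by apply: is_derive_eq; rewrite scaler0 add0r [LHS]mulr1.
  by have := @is_derive1_comp R (fun r : R => g (r *: b + x)) ( *%R^~ s) t _ _ d1 d2.
have cphi : {within `[0, 1], continuous phi}.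
  by apply: derivable_within_continuous => t _; case: (dphi t).
have [c c01] := MVT_segment ler01 (fun t _ => dphi t) cphi.
rewrite /phi mul1r mul0r scale0r add0r subr0 mulr1 => ->.
rewrite normrM ler_wpM2r// B_ub// normrM ler_piMl//.
by move: c01; rewrite in_itv/= ler_norml; lra.
Qed.

(** This is 1 + |x|^2 for the Euclidean norm, written without the square root so that estimates on
    it are polynomial in the coordinates. *)
Definition weight (x : R3) : R := 1 + x.1.1 ^+ 2 + x.1.2 ^+ 2 + x.2 ^+ 2.

Lemma weight_ge1 x : 1 <= weight x.
Proof. by rewrite /weight; nra. Qed.

Lemma weight_ge0 x : 0 <= weight x.
Proof. exact: le_trans (weight_ge1 x). Qed.

Lemma weight_gt0 x : 0 < weight x.
Proof. exact: lt_le_trans (weight_ge1 x). Qed.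

Lemma weight_expn_gt0 x n : 0 < weight x ^+ n.
Proof. by rewrite exprn_gt0// weight_gt0. Qed.

Lemma weight_enorm x : weight x = 1 + enorm x ^+ 2.
Proof. by rewrite /weight /enorm sqr_sqrtr; [ring | nra]. Qed.

(* Peetre's inequality *)
Lemma weightD x y : weight (x + y) <= 2 * (weight x * weight y).
Proof.
have sqD (a b : R) : (a + b) ^+ 2 <= 2 * a ^+ 2 + 2 * b ^+ 2.
  by have := sqr_ge0 (a - b); nra.
have := sqD x.1.1 y.1.1; have := sqD x.1.2 y.1.2; have := sqD x.2 y.2.
rewrite /weight /=.
have := sqr_ge0 x.1.1; have := sqr_ge0 x.1.2; have := sqr_ge0 x.2.
have := sqr_ge0 y.1.1; have := sqr_ge0 y.1.2; have := sqr_ge0 y.2.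
set a := _ ^+ 2; set b := _ ^+ 2; set c := _ ^+ 2.
set a' := _ ^+ 2; set b' := _ ^+ 2; set c' := _ ^+ 2.
move=> ? ? ? ? ? ? ? ? ?.
have : 0 <= (a + b + c) * (a' + b' + c') by rewrite mulr_ge0 ?addr_ge0.
by lra.
Qed.

Lemma weightD_expn x y n :
  weight (x + y) ^+ n <= 2 ^+ n * (weight x ^+ n * weight y ^+ n).
Proof. by rewrite -!exprMn lerXn2r ?nnegrE ?mulr_ge0 ?weight_ge0 ?weightD. Qed.

Definition poly_bounded g := exists C n, forall x, `|g x| <= C * weight x ^+ n.

Lemma poly_bounded_ball1 g x : poly_bounded g ->
  exists2 B, 0 <= B & forall y, `|y| <= 1 -> `|g (y + x)| <= B.
Proof.
(* The factor 2 comes from Peetre's inequality, and 4 bounds [weight] on the unit ball of the sup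
   norm. The sign of [C] is unknown, hence the absolute value. *)
move=> [C [n Cg]]; exists (`|C| * (2 ^+ n * (4 ^+ n * weight x ^+ n))).
  by rewrite !mulr_ge0// exprn_ge0// weight_ge0.
move=> y; rewrite !prod_normE/= !ge_max => /andP[/andP[h1 h2] h3].
apply: (le_trans (Cg _)).
apply: (le_trans (ler_wpM2r _ (ler_norm C))); first exact/ltW/weight_expn_gt0.
rewrite ler_wpM2l//; apply: (le_trans (weightD_expn _ _ _)).
rewrite ler_wpM2l ?exprn_ge0// ler_wpM2r ?exprn_ge0 ?weight_ge0//.
rewrite lerXn2r ?nnegrE ?weight_ge0//.
by move: h1 h2 h3; rewrite /weight !ler_norml; nra.
Qed.

Lemma basis_decomp x :
  x = x.1.1 *: basis R 0 + (x.1.2 *: basis R 1 + x.2 *: basis R 2%R).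
Proof.
case: x => -[a b] c; rewrite /basis/=; congr (_, _, _);
  by rewrite /= /GRing.scale /= !(mulr1, mulr0) ?addr0 ?add0r.
Qed.

(** Partial derivatives alone do not give continuity, but locally bounded ones do: [g] is then
    Lipschitz along each axis near [x], and [y + x] is reached from [x] in three axis-parallel
    steps. *)
Lemma poly_bounded_partial_continuous g (g' : 'I_3 -> R3 -> R) :
  (forall i x, is_derive x (basis R i) g (g' i x)) ->
  (forall i, poly_bounded (g' i)) -> continuous g.
Proof.
move=> gg' bg' x.
have [B B0 B_ub] : exists2 B, 0 <= B &
    forall i y, `|y| <= 1 -> `|g' i (y + x)| <= B.
  have /choice[B B_ub] i : exists B, 0 <= B /\
      forall y, `|y| <= 1 -> `|g' i (y + x)| <= B.
    by have [B ? ?] := poly_bounded_ball1 x (bg' i); exists B.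
  exists (\sum_i B i); first by apply: sumr_ge0 => i _; case: (B_ub i).
  move=> i y y1; apply: (le_trans ((B_ub i).2 y y1)).
  by rewrite (bigD1 i)//= lerDl sumr_ge0// => j _; case: (B_ub j).
have step i (y : R3) (s : R) :
    (forall t : R, `|t| <= `|s| -> `|t *: basis R i + y| <= 1) ->
    `|g (s *: basis R i + (y + x)) - g (y + x)| <= B * `|s|.
  move=> y1; apply: (line_mean_value (gg' i)) => t ts.
  by rewrite addrA B_ub// y1.
(* The path switches on the coordinates of [y] from the last to the first. Its points differ from
   [x] by vectors of sup norm at most [|y|], so [B] applies all along it. *)
have incr y : `|y| <= 1 -> `|g (y + x) - g x| <= B * 3 * `|y|.
  have [h1 h2 h3] : [/\ `|y.1.1| <= `|y|, `|y.1.2| <= `|y| & `|y.2| <= `|y|].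
    by rewrite !prod_normE/= !le_max !lexx ?orbT.
  move=> y1.
  have s2 := @step 2%R 0 y.2; rewrite add0r in s2.
  have s1 := @step 1 (y.2 *: basis R 2%R) y.1.2; rewrite addrA in s1.
  have := @step 0 (y.1.2 *: basis R 1 + y.2 *: basis R 2%R) y.1.1.
  rewrite addrA -basis_decomp => s0.
  have {}s0 : `|g (y + x) - g (y.1.2 *: basis R 1 + y.2 *: basis R 2%R + x)| <= B * `|y|.
    apply: le_trans (ler_wpM2l B0 h1); apply: s0 => t ty.
    rewrite !prod_normE/= /GRing.scale/= !(mulr0, mulr1, addr0, add0r) !ge_max.
    by rewrite (le_trans ty)?(le_trans h1)?(le_trans h2)?(le_trans h3).
  have {}s1 : `|g (y.1.2 *: basis R 1 + y.2 *: basis R 2%R + x)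
               - g (y.2 *: basis R 2%R + x)| <= B * `|y|.
    apply: le_trans (ler_wpM2l B0 h2); apply: s1 => t ty.
    rewrite !prod_normE/= /GRing.scale/= !(mulr0, mulr1, addr0, add0r) !ge_max.
    by rewrite normr0 ler01 (le_trans ty)?(le_trans h2)?(le_trans h3).
  have {}s2 : `|g (y.2 *: basis R 2%R + x) - g x| <= B * `|y|.
    apply: le_trans (ler_wpM2l B0 h3); apply: s2 => t ty.
    rewrite !prod_normE/= /GRing.scale/= !(mulr0, mulr1, addr0, add0r) !ge_max.
    by rewrite normr0 ler01 (le_trans ty)?(le_trans h3).
  have := ler_distD (g (y.1.2 *: basis R 1 + y.2 *: basis R 2%R + x)) (g (y + x)) (g x).
  have := ler_distD (g (y.2 *: basis R 2%R + x))
    (g (y.1.2 *: basis R 1 + y.2 *: basis R 2%R + x)) (g x).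
  by lra.
apply/cvgrPdist_le => e e0.
(* The minimum with 1 keeps [y - x] in the ball where [B] is valid; the [+ 1] in the denominator
   covers [B = 0]. *)
pose d := Num.min 1 (e / (B * 3 + 1)).
have d0 : 0 < d by rewrite lt_min ltr01 divr_gt0// ltr_wpDl// mulr_ge0.
near=> y.
have : `|y - x| <= d by rewrite distrC; near: y; exact: cvgr_dist_le.
rewrite le_min => /andP[yx1 yxe].
rewrite distrC -[y in g y](subrK x); apply: (le_trans (incr _ yx1)).
have B3 : 0 <= B * 3 by rewrite mulr_ge0.
move: yxe; rewrite ler_pdivlMr; last by lra.
by have := normr_ge0 (y - x); nra.
Unshelve. all: by end_near.
Qed.

(* A family of polynomially bounded functions that is closed under partial
   derivatives consists of smooth functions. *)
Variable S : set (R3 -> R).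
Hypothesis S_bounded : forall g, S g -> poly_bounded g.
Hypothesis S_partial : forall i g, S g ->
  exists2 g', S g' & forall x, is_derive x (basis R i) g (g' x).

Lemma closed_partial i g : S g -> S (partial i g).
Proof.
move=> /(S_partial i)[g' Sg' gg']; suff -> : partial i g = g' by [].
by apply/funext => x; apply: (derive_val (is_derive := gg' x)).
Qed.

Lemma closed_continuous g : S g -> continuous g.
Proof.
move=> Sg; have /choice[g' gg'] i : exists g', S g' /\
    forall x, is_derive x (basis R i) g (g' x).
  by have [g' ? ?] := S_partial i Sg; exists g'.
by apply: (@poly_bounded_partial_continuous g g') => i; case: (gg' i) => // /S_bounded.
Qed.

Lemma closed_smooth g : S g -> smooth g.
Proof.
move=> Sg js; have Sgjs : S (foldr (@partial R) g js).
  by elim: js => //= i js; exact: closed_partial.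
split=> [|i x]; first exact: closed_continuous.
by have [g' _ /(_ x)[]] := S_partial i Sgjs.
Qed.

Lemma closed_Dalpha alpha g : S g -> S (Dalpha alpha g).
Proof.
have iterS i n f : S f -> S (iter n (partial i) f).
  by elim: n f => //= n IHn f Sf; apply: closed_partial; exact: IHn.
by move=> Sg; exact: (iterS _ _ _ (iterS _ _ _ (iterS _ _ _ Sg))).
Qed.

End DirectionalDerivatives.

(** * Polynomials times a one-variable Gaussian *)

Section OneDimensional.
Variables (R : realType) (a : R).
Implicit Types p : {poly R}.

Definition pgauss p (t : R) : R := p.[t] * expR (- (a * t ^+ 2)).

Lemma is_derive_pgauss p (t : R) :
  is_derive t 1 (pgauss p) (pgauss (p^`() - (2 * a) *: ('X * p)) t).
Proof.
have d1 : is_derive t 1 (horner p) p^`().[t] by exact: is_derive_poly.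
have d2 : is_derive t 1 (fun s : R => - (a * s ^+ 2)) (- (2 * a * t)).
  have -> : (fun s : R => - (a * s ^+ 2)) = horner (- a *: 'X^2).
    by apply/funext => s; rewrite hornerZ hornerXn mulNr.
  by apply: is_derive_eq (is_derive_poly _ _) _;
    rewrite derivZ derivXn hornerZ hornerMn hornerXn; ring.
have d3 := @is_derive1_comp R expR _ t _ _ (is_derive_expR _) d2.
apply: (is_derive_eq (is_deriveM d1 d3)).
by rewrite /pgauss hornerD hornerN hornerZ hornerM hornerX /GRing.scale/=; ring.
Qed.

Lemma measurable_pgauss p : measurable_fun setT (pgauss p).
Proof.
apply: measurable_funM; first exact: measurable_poly.
apply: measurableT_comp => //; apply: measurableT_comp => //.
exact: measurable_funM.
Qed.

End OneDimensional.

(** Induction on the polynomial with [a] general: for [p * 'X + c%:P] the exponential is split into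
    two equal factors, one absorbing the new factor [t], the other left to the induction hypothesis
    at [a / 2]. *)
Lemma pgauss_bounded (R : realType) (a : R) (p : {poly R}) :
  0 < a -> exists M, forall t, `|pgauss a p t| <= M.
Proof.
elim/poly_ind: p a => [|p c IHp] a a0.
  by exists 0 => t; rewrite /pgauss horner0 mul0r normr0.
have [M M_ub] := IHp _ (divr_gt0 a0 (ltr0Sn R 1)).
exists (M * (1 + (a / 2)^-1) + `|c|) => t.
have E1 : expR (- (a * t ^+ 2)) = expR (- (a / 2 * t ^+ 2)) * expR (- (a / 2 * t ^+ 2)).
  by rewrite -expRD; congr expR; field.
have le1 s : 0 <= s -> expR (- s) <= 1 by rewrite -expR0 ler_expR oppr_le0.
have lin : `|t| * expR (- (a / 2 * t ^+ 2)) <= 1 + (a / 2)^-1.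
  set b := a / 2; have b0 : 0 < b by rewrite divr_gt0.
  rewrite expRN ler_pdivrMr ?expR_gt0//.
  have h := expR_ge1Dx (b * t ^+ 2).
  have bi : 0 < b^-1 by rewrite invr_gt0.
  (* Here exp(b t^2) >= 1 + b t^2, and the expanded product contains 1 + t^2, which dominates
     [|t|]. *)
  apply: (@le_trans _ _ ((1 + b^-1) * (1 + b * t ^+ 2))); last by rewrite ler_wpM2l//; lra.
  have -> : (1 + b^-1) * (1 + b * t ^+ 2) = 1 + b * t ^+ 2 + b^-1 + t ^+ 2.
    by field; rewrite gt_eqF.
  have := sqr_ge0 t; have := mulr_ge0 (ltW b0) (sqr_ge0 t).
  have := sqr_ge0 (`|t| - 1); rewrite sqrrB1 real_normK ?num_real//.
  by have := normr_ge0 t; lra.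
rewrite /pgauss hornerMXaddC mulrDl; apply: (le_trans (ler_normD _ _)); apply: lerD; last first.
  by rewrite normrM (ger0_norm (expR_ge0 _)) ler_piMr// le1// mulr_ge0 ?sqr_ge0// ltW.
have -> : p.[t] * t * expR (- (a * t ^+ 2)) =
    pgauss (a / 2) p t * (t * expR (- (a / 2 * t ^+ 2))).
  by rewrite E1 /pgauss; ring.
rewrite normrM ler_pM// normrM (ger0_norm (expR_ge0 _))//.
Qed.

(** * Products of three one-variable functions of this kind *)

Section GaussianTensors.
Variables (R : realType) (a : R).
Hypothesis a_gt0 : 0 < a.
Local Notation R3 := (R * R * R)%type.
Implicit Types (p q r : {poly R}) (x y b : R3).

Definition tgauss p q r y := pgauss a p y.1.1 * pgauss a q y.1.2 * pgauss a r y.2.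

(** A partial derivative acts on a single factor. The new polynomials are chosen before [y], so the
    derivative is again a function of the same class. *)
Lemma is_derive_tgauss p q r (i : 'I_3) : exists p' q' r', forall y,
  is_derive y (basis R i) (tgauss p q r) (tgauss p' q' r' y).
Proof.
pose D p := p^`() - (2 * a) *: ('X * p).
(* On a line parallel to the axis, two factors are constant and merge into [K]; only the third
   depends on [t]. *)
have slice y s (K c : R) :
    (forall t : R, tgauss p q r (t *: basis R i + y) = K * pgauss a s (t + c)) ->
    is_derive y (basis R i) (tgauss p q r) (K * pgauss a (D s) c).
  move=> line; rewrite -[y]add0r -(scale0r (basis R i)); apply/is_derive_line.
  rewrite (funext line : (fun t : R => _) = _).
  have d1 : is_derive ((0 : R) + c) 1 (pgauss a s) (pgauss a (D s) c).
    by rewrite add0r; exact: is_derive_pgauss.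
  have d2 : is_derive (0 : R) 1 (fun t : R => t + c) 1.
    by apply: is_derive_eq; rewrite addr0.
  have := is_deriveZ K (@is_derive1_comp R (pgauss a s) ( +%R^~ c) 0 _ _ d1 d2).
  by rewrite mulr1.
move: i slice => [[|[|[|//]]] i3] slice;
  [exists (D p), q, r | exists p, (D q), r | exists p, q, (D r)] => y.
- apply: is_derive_eq (slice y p (pgauss a q y.1.2 * pgauss a r y.2) y.1.1 _) _.
    by move=> t; rewrite /tgauss/= /GRing.scale/= !(mulr0, mulr1, add0r); ring.
  by rewrite /tgauss; ring.
- apply: is_derive_eq (slice y q (pgauss a p y.1.1 * pgauss a r y.2) y.1.2 _) _.
    by move=> t; rewrite /tgauss/= /GRing.scale/= !(mulr0, mulr1, add0r); ring.
  by rewrite /tgauss; ring.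
- apply: is_derive_eq (slice y r (pgauss a p y.1.1 * pgauss a q y.1.2) y.2 _) _.
    by move=> t; rewrite /tgauss/= /GRing.scale/= !(mulr0, mulr1, add0r); ring.
  by rewrite /tgauss; ring.
Qed.

(** The weight is at most the product of the factors 1 + t^2 over the three coordinates. Their
    powers are absorbed into the polynomials, so boundedness in one variable suffices. *)
Lemma tgauss_decay p q r n : exists2 M, 0 <= M &
  forall y, `|tgauss p q r y| <= M / weight y ^+ n.
Proof.
have B s : exists2 M, 0 <= M & forall t, `|pgauss a s t| * (1 + t ^+ 2) ^+ n <= M.
  have [M M_ub] := pgauss_bounded (s * (1 + 'X^2) ^+ n) a_gt0.
  exists M => [|t]; first exact: le_trans (normr_ge0 _) (M_ub 0).
  apply: le_trans (M_ub t); rewrite /pgauss hornerM horner_exp hornerD hornerC hornerXn !normrM.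
  rewrite (@ger0_norm _ ((1 + t ^+ 2) ^+ n)); last by rewrite exprn_ge0// addr_ge0 ?sqr_ge0.
  by rewrite mulrAC.
have [M1 M10 H1] := B p; have [M2 M20 H2] := B q; have [M3 M30 H3] := B r.
exists (M1 * M2 * M3) => [|y]; first by rewrite !mulr_ge0.
rewrite ler_pdivlMr ?weight_expn_gt0//.
pose u (t : R) := (1 + t ^+ 2) ^+ n.
have u0 t : 0 <= u t by rewrite exprn_ge0// addr_ge0 ?sqr_ge0.
apply: (@le_trans _ _ (`|tgauss p q r y| * (u y.1.1 * u y.1.2 * u y.2))).
  rewrite ler_wpM2l// /u -!exprMn lerXn2r ?nnegrE ?weight_ge0//.
    by rewrite !mulr_ge0// addr_ge0 ?sqr_ge0.
  have := sqr_ge0 y.1.1; have := sqr_ge0 y.1.2; have := sqr_ge0 y.2; rewrite /weight.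
  set A := _ ^+ 2; set B' := _ ^+ 2; set C := _ ^+ 2 => A0 B0 C0.
  have := mulr_ge0 A0 B0; have := mulr_ge0 A0 C0; have := mulr_ge0 B0 C0.
  by have := mulr_ge0 (mulr_ge0 A0 B0) C0; lra.
rewrite /tgauss 2!normrM mulrACA [X in X * _]mulrACA.
by rewrite !ler_pM ?mulr_ge0//.
Qed.

End GaussianTensors.

(** * Translated Gaussians as Schwartz test functions *)

Section Translates.
Variables (R : realType) (a : R).
Hypothesis a_gt0 : 0 < a.
Local Notation R3 := (R * R * R)%type.
Implicit Types (p q r : {poly R}) (x y b : R3).

Lemma is_derive_shift (g : R3 -> R) (b v y : R3) (df : R) :
  is_derive (y + b) v g df -> is_derive y v (fun z => g (z + b)) df.
Proof.
have E : (fun h : R => h^-1 *: (g (h *: v + (y + b)) - g (y + b))) =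
    (fun h : R => h^-1 *: ((fun z => g (z + b)) (h *: v + y) - (fun z => g (z + b)) y)).
  by apply/funext => h /=; rewrite addrA.
by case=> d1 d2; split; move: d1 d2; rewrite /derivable /derive E.
Qed.

Definition tgauss_translates b : set (R3 -> R) :=
  [set g | exists p q r, g = fun y => tgauss a p q r (y - b)].

Lemma weight_subl x y n : weight x ^+ n <= 2 ^+ n * (weight y ^+ n * weight (x - y) ^+ n).
Proof. by rewrite -{1}(subrKC y x) weightD_expn. Qed.

Lemma tgauss_translates_decay b g n : tgauss_translates b g ->
  exists2 M, 0 <= M & forall y, weight y ^+ n * `|g y| <= M.
Proof.
move=> [p [q [r ->]]]; have [M M0 M_ub] := tgauss_decay a_gt0 p q r n.
exists (2 ^+ n * weight b ^+ n * M) => [|y].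
  by rewrite !mulr_ge0 ?exprn_ge0 ?weight_ge0.
have := M_ub (y - b); rewrite ler_pdivlMr ?weight_expn_gt0// => H.
apply: le_trans (ler_wpM2r (normr_ge0 _) (weight_subl y b n)) _.
rewrite -!mulrA !ler_wpM2l ?exprn_ge0 ?weight_ge0//.
by rewrite mulrC.
Qed.

Lemma tgauss_translates_bounded b g : tgauss_translates b g -> poly_bounded g.
Proof.
move=> /(tgauss_translates_decay 0)[M _ M_ub]; exists M, 0%N => y.
by have := M_ub y; rewrite !expr0 mul1r mulr1.
Qed.

Lemma tgauss_translates_partial b i g : tgauss_translates b g ->
  exists2 g', tgauss_translates b g' & forall y, is_derive y (basis R i) g (g' y).
Proof.
move=> [p [q [r ->]]]; have [p' [q' [r' dg]]] := is_derive_tgauss a p q r i.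
exists (fun y => tgauss a p' q' r' (y - b)); first by exists p', q', r'.
by move=> y; apply: is_derive_shift; exact: dg.
Qed.

(** Needed because a regular distribution is given by its density on Schwartz functions only. The
    decay follows from [enorm x <= weight x]. *)
Lemma tgauss_translates_schwartz b g : tgauss_translates b g -> schwartz g.
Proof.
move=> Sg; split.
  exact: (closed_smooth (@tgauss_translates_bounded b) (@tgauss_translates_partial b)).
move=> k alpha.
have := closed_Dalpha (@tgauss_translates_partial b) alpha Sg.
move=> /(tgauss_translates_decay k)[M _ M_ub]; exists M => x.
apply: le_trans (M_ub x); rewrite ler_wpM2r// lerXn2r ?nnegrE ?weight_ge0//.
  exact: sqrtr_ge0.
by rewrite weight_enorm; nra.
Qed.

(** Stated for constant polynomials, which covers the kernel itself. It turns the reflected function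
    x' |-> E(x - x') into the translate of E centred at x. *)
Lemma tgauss_even (c d e : R) y :
  tgauss a c%:P d%:P e%:P (- y) = tgauss a c%:P d%:P e%:P y.
Proof. by rewrite /tgauss /pgauss !hornerC !sqrrN. Qed.

Lemma measurable_tgauss_reflect p q r x :
  measurable_fun [set: measurableTypeR R * measurableTypeR R * measurableTypeR R]
    (fun y => tgauss a p q r (x - y)).
Proof.
have m (s : {poly R}) (c : R) (u : measurableTypeR R * measurableTypeR R * measurableTypeR R
    -> measurableTypeR R) :
    measurable_fun setT u -> measurable_fun setT (fun y => pgauss a s (c - u y)).
  move=> mu; apply: (measurableT_comp (measurable_pgauss a s)).
  exact: measurable_funB.
apply: measurable_funM; [apply: measurable_funM|]; apply: m.
- exact: measurableT_comp.
- exact: measurableT_comp.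
- by [].
Qed.

End Translates.

(** * Integrals of a density of slow growth against Gaussian tensors *)

Section GaussianSmoothing.
Variables (R : realType) (a : R).
Hypothesis a_gt0 : 0 < a.
Local Notation R3 := (R * R * R)%type.
Local Notation mR3 := (measurableTypeR R * measurableTypeR R * measurableTypeR R)%type.
Local Notation mu := (@lebesgue3 R).
Variables (f : R3 -> R) (n : nat).
Hypothesis mf : measurable_fun [set: mR3] f.
Hypothesis intf : mu.-integrable setT (fun y => (f y / weight y ^+ n)%:E).
Implicit Types (p q r : {poly R}) (x y : R3).

(** In Peetre's inequality for [y = x + (y - x)], decay of order [n] absorbs the weight of [y - x].
    As [x] enters only through a separate factor, this one estimate gives integrability, the growth
    bound and the domination needed to differentiate. *)
Lemma tgauss_reflect_decay p q r : exists2 M, 0 <= M & forall x y,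
  `|f y * tgauss a p q r (x - y)| <= M * weight x ^+ n * `|f y / weight y ^+ n|.
Proof.
have [M M0 M_ub] := tgauss_decay a_gt0 p q r n.
exists (M * 2 ^+ n) => [|x y]; first by rewrite mulr_ge0// exprn_ge0.
have := M_ub (x - y); rewrite ler_pdivlMr ?weight_expn_gt0// => H.
rewrite !(normrM (f y)) normfV (ger0_norm (ltW (weight_expn_gt0 y n))) [leRHS]mulrCA ler_wpM2l//.
rewrite ler_pdivlMr ?weight_expn_gt0//.
apply: le_trans (ler_wpM2l (normr_ge0 _) (weight_subl y x n)) _.
have -> : weight (y - x) = weight (x - y).
  by rewrite -opprB /weight/= !sqrrN.
have -> : forall A B C D : R, A * (B * (C * D)) = A * D * (B * C) by move=> *; ring.
by rewrite -[leRHS]mulrA ler_wpM2r// mulr_ge0 ?exprn_ge0 ?weight_ge0.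
Qed.

Lemma integrable_tgauss_reflect p q r x :
  mu.-integrable setT (fun y => (f y * tgauss a p q r (x - y))%:E).
Proof.
have [M M0 M_ub] := tgauss_reflect_decay p q r.
have intK := integrableZl measurableT (M * weight x ^+ n) intf.
apply: (le_integrable measurableT _ _ intK).
- apply/measurable_EFinP; apply: measurable_funM => //.
  exact: measurable_tgauss_reflect.
- move=> y _; rewrite -EFinM !abse_EFin lee_fin normrM (@ger0_norm _ (M * _)) ?M_ub//.
  by rewrite mulr_ge0// exprn_ge0 ?weight_ge0.
Qed.

Definition tgauss_smoothings : set (R3 -> R) :=
  [set g | exists p q r, g = fun x => \int[mu]_y (f y * tgauss a p q r (x - y))].

Lemma tgauss_smoothings_bound g : tgauss_smoothings g ->
  exists C, forall x, `|g x| <= C * weight x ^+ n.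
Proof.
move=> [p [q [r ->]]]; have [M M0 M_ub] := tgauss_reflect_decay p q r.
have intfn : mu.-integrable setT (EFin \o (fun y => `|f y / weight y ^+ n|)).
  exact: integrable_norm.
exists (M * \int[mu]_y `|f y / weight y ^+ n|) => x.
have intx := integrable_tgauss_reflect p q r x.
apply: le_trans (le_normr_Rintegral measurableT intx) _.
rewrite mulrAC -RintegralZl//; apply: le_Rintegral => //.
- exact: integrable_norm.
- under [X in _.-integrable _ X]eq_fun do rewrite /= EFinM.
  exact: integrableZl.
Qed.

(** The derivative falls on the Gaussian factor while [f] is unchanged, so the exponent [n] is the
    same for all derivatives. *)
Lemma tgauss_smoothings_partial i g : tgauss_smoothings g ->
  exists2 g', tgauss_smoothings g' & forall x, is_derive x (basis R i) g (g' x).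
Proof.
move=> [p [q [r ->]]]; have [p' [q' [r' dg]]] := is_derive_tgauss a p q r i.
exists (fun x => \int[mu]_y (f y * tgauss a p' q' r' (x - y))).
  by exists p', q', r'.
move=> x; rewrite -[x]add0r -(scale0r (basis R i)); apply/is_derive_line.
pose F (t : R) (y : mR3) := f y * tgauss a p q r (t *: basis R i + x - y).
have dF (t : R) y :
    is_derive t (1 : R) (F^~ y) (f y * tgauss a p' q' r' (t *: basis R i + x - y)).
  have /is_derive_line := is_derive_shift (dg (t *: basis R i + x - y)).
  exact: is_deriveZ.
have d1F (t : R) y : partial1of2 F t y = f y * tgauss a p' q' r' (t *: basis R i + x - y).
  by rewrite partial1of2E; exact: derive_val.
have [M M0 M_ub] := tgauss_reflect_decay p' q' r'.
(* A bound uniform for [t] in ]-1, 1[: in 4 = 2 * 2, one factor comes from Peetre's inequality and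
   the other bounds the weight 1 + t^2 of [t *: basis R i]. *)
pose G (y : mR3) := M * (4 ^+ n * weight x ^+ n) * `|f y / weight y ^+ n|.
have G0 y : 0 <= G y by rewrite !mulr_ge0 ?exprn_ge0 ?weight_ge0.
have intG : mu.-integrable setT (EFin \o G).
  rewrite /G; under [X in _.-integrable _ X]eq_fun do rewrite /= EFinM.
  by apply: integrableZl => //; exact: integrable_norm.
have I0 : `](-1), 1[%classic (0 : R) by rewrite /= in_itv/=; lra.
have intF t : `](-1), 1[%classic t -> mu.-integrable setT (EFin \o F t).
  by move=> _; exact: integrable_tgauss_reflect.
have derF t y : `](-1), 1[%classic t -> setT y -> derivable (F^~ y) t 1.
  by move=> _ _; case: (dF t y).
have dF_ub t y : `](-1), 1[%classic t -> setT y -> `|partial1of2 F t y| <= G y.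
  rewrite /= in_itv/= => t1 _; rewrite d1F; apply: le_trans (M_ub _ _) _.
  rewrite ler_wpM2r// ler_wpM2l//.
  apply: le_trans (weightD_expn _ _ _) _.
  rewrite mulrA ler_wpM2r ?exprn_ge0 ?weight_ge0// -exprMn lerXn2r ?nnegrE ?mulr_ge0 ?weight_ge0//.
  have : t ^+ 2 <= 1 by nra.
  by move=> t2; case: (i) => -[|[|[|//]]] ?; rewrite /weight/= /GRing.scale/= !(mulr0, mulr1); lra.
split; first exact: (derivable_under_integral measurableT I0 intF derF G0 intG dF_ub).
rewrite -derive1E (differentiation_under_integral measurableT I0 intF derF G0 intG dF_ub).
by under eq_Rintegral do rewrite d1F.
Qed.

Lemma tgauss_smoothings_smooth g : tgauss_smoothings g -> smooth g.
Proof.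
apply: closed_smooth; last exact: tgauss_smoothings_partial.
by move=> h /tgauss_smoothings_bound[C C_ub]; exists C, n.
Qed.

Lemma tgauss_smoothings_Dalpha_bound g alpha : tgauss_smoothings g ->
  exists C, forall x, `|Dalpha alpha g x| <= C * weight x ^+ n.
Proof.
move=> /(closed_Dalpha tgauss_smoothings_partial alpha).
exact: tgauss_smoothings_bound.
Qed.

End GaussianSmoothing.

(** * Application to the kernel and to regular tempered distributions *)

Lemma gauss_kernelE (R : realType) (l : R) : 0 < l ->
  gauss_kernel l = tgauss (4 * l ^+ 2)^-1 ((2 * l * Num.sqrt pi) ^+ 3)^-1%:P 1%:P 1%:P.
Proof.
move=> l0; apply/funext => y; rewrite /gauss_kernel /enorm sqr_sqrtr; last by nra.
rewrite /tgauss /pgauss !hornerC !mul1r -!mulrA -!expRD; congr (_ * expR _).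
by field; rewrite gt_eqF.
Qed.

(** The real exponent of slow growth is traded for natural ones. All large [n] are allowed, so that
    several densities can share one exponent. *)
Lemma slow_growth_integrable (R : realType) (f : R * R * R -> R) :
  measurable_fun
    [set: measurableTypeR R * measurableTypeR R * measurableTypeR R] f ->
  slow_growth f -> exists n0, forall n, (n0 <= n)%N ->
    (@lebesgue3 R).-integrable setT (fun y => (f y / weight y ^+ n)%:E).
Proof.
(* This bound exceeds [r], hence [r / 2]; as the weight is at least 1, larger exponents only make
   the integrand smaller. *)
move=> mf [r r0 intf]; exists (Num.truncn r).+1 => n rn.
have mw : measurable_fun
    [set: measurableTypeR R * measurableTypeR R * measurableTypeR R] (@weight R).
  rewrite /weight; apply: measurable_funD; [apply: measurable_funD; [apply: measurable_funD|]|];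
  by [|apply: measurable_funX => //; exact: measurableT_comp].
have wr y : weight y ^- n <= (1 + enorm y ^+ 2) `^ (- (r / 2)).
  rewrite -weight_enorm -powR_mulrn ?weight_ge0// -powRN.
  rewrite ler_powR ?weight_ge1// lerN2.
  apply: (@le_trans _ _ r); first by lra.
  by apply: (le_trans (ltW (truncnS_gt r))); rewrite ler_nat.
have mfw : measurable_fun
    [set: measurableTypeR R * measurableTypeR R * measurableTypeR R]
    (fun y => f y / weight y ^+ n).
  apply: measurable_funM => //.
  rewrite (_ : (fun y => _) = fun y => weight y `^ (- n%:R)); last first.
    by apply/funext => y; rewrite powRN powR_mulrn ?weight_ge0.
  exact: (measurableT_comp (measurable_powR (- n%:R : R)) mw).
apply/integrableP; split; first exact/measurable_EFinP.
apply: le_lt_trans intf; apply: ge0_le_integral => //.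
- apply/measurable_EFinP; exact: measurableT_comp.
- apply/measurable_EFinP; apply: measurable_funM; first exact: measurableT_comp.
  under eq_fun do rewrite -weight_enorm.
  exact: (measurableT_comp (measurable_powR (- (r / 2))) mw).
- move=> y _; rewrite abse_EFin lee_fin normrM ler_wpM2l//.
  by rewrite ger0_norm ?wr// invr_ge0 ltW// weight_expn_gt0.
Qed.

(** The threshold [n0] comes from the density alone and precedes [alpha], which makes the final
    exponent uniform in the order of the derivative. *)
Lemma regular_convolution_bound (R : realType) (l : R) (T : (R * R * R -> R) -> R) :
  0 < l -> regular_tempered T -> exists n0, forall n, (n0 <= n)%N ->
  let h := convolution (gauss_kernel l) T in
  smooth h /\ forall alpha, exists C, forall x, `|Dalpha alpha h x| <= C * weight x ^+ n.
Proof.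
move=> l0 [_ [f [[mf _] sf Tf]]].
have [n0 intf] := slow_growth_integrable mf sf; exists n0 => n /intf{}intf h.
have a0 : 0 < (4 * l ^+ 2)^-1 by rewrite invr_gt0 mulr_gt0// exprn_gt0.
have Sh : tgauss_smoothings (4 * l ^+ 2)^-1 f h.
  exists ((2 * l * Num.sqrt pi) ^+ 3)^-1%:P, 1%:P, 1%:P.
  apply/funext => x; rewrite /h /convolution -gauss_kernelE// Tf//.
  apply: (@tgauss_translates_schwartz _ _ a0 x).
  exists ((2 * l * Num.sqrt pi) ^+ 3)^-1%:P, 1%:P, 1%:P.
  by apply/funext => y; rewrite gauss_kernelE// -opprB tgauss_even.
split; first exact: (tgauss_smoothings_smooth a0 mf intf).
by move=> alpha; exact: (tgauss_smoothings_Dalpha_bound a0 mf intf).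
Qed.

(** With u = |x|^2, the reason is (1 + u)^n <= (2 max(1, u))^n; the two cases are treated
    separately. *)
Lemma weight_expn_le (R : realType) (x : R * R * R) n :
  weight x ^+ n <= 2 ^+ n * (1 + enorm x ^+ (2 * n)).
Proof.
rewrite weight_enorm exprM; set u := enorm x ^+ 2.
have u0 : 0 <= u by exact: sqr_ge0.
have un0 : 0 <= u ^+ n by rewrite exprn_ge0.
have [u1|u1] := leP u 1.
  apply: (@le_trans _ _ (2 ^+ n)); last by rewrite ler_peMr ?exprn_ge0//; lra.
  by rewrite lerXn2r ?nnegrE//; lra.
apply: (@le_trans _ _ ((2 * u) ^+ n)); first by rewrite lerXn2r ?nnegrE//; lra.
by rewrite exprMn ler_wpM2l ?exprn_ge0//; lra.
Qed.

Theorem proposition3p4 (R : realType) (l : R) (l_gt0 : 0 < l)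
    (Phi : 'I_4 -> 'I_4 -> (R * R * R -> R) -> R)
    (Phi_regular : forall mu nu, regular_tempered (Phi mu nu)) :
  let h := fun mu nu => convolution (gauss_kernel l) (Phi mu nu) in
  (forall mu nu, smooth (h mu nu)) /\
  exists s : nat, forall alpha : 'I_3 -> nat,
    exists C : 'I_4 -> 'I_4 -> R,
      forall (mu nu : 'I_4) (x : R * R * R),
        `|Dalpha alpha (h mu nu) x| <= C mu nu * (1 + enorm x ^+ s).
Proof.
move=> h.
have /choice[N hN] (k : 'I_4 * 'I_4) := regular_convolution_bound l_gt0 (Phi_regular k.1 k.2).
split=> [mu nu|]; first by case: (hN (mu, nu) _ (leqnn _)).
(* The maximum over the sixteen index pairs serves all components at once; the exponent doubles
   because the weight is quadratic in |x|. *)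
pose n := \max_k N k; exists (2 * n)%N => alpha.
have /choice[C hC] (k : 'I_4 * 'I_4) : exists C, forall x,
    `|Dalpha alpha (h k.1 k.2) x| <= C * weight x ^+ n.
  by have [_] := hN k n (leq_bigmax k); exact.
exists (fun mu nu => `|C (mu, nu)| * 2 ^+ n) => mu nu x.
apply: le_trans (hC (mu, nu) x) _; rewrite -mulrA.
apply: le_trans (ler_wpM2r (ltW (weight_expn_gt0 x n)) (ler_norm _)) _.
by rewrite ler_wpM2l// weight_expn_le.
Qed.
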